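(* Let $\mathbb{K}_2^n\subset\mathbb{R}^n$ be the second-order cone, let $c_1,c_2\in\mathbb{R}^n$ and $c_{1,0},c_{2,0}\in\{0,\pm1\}$ with $c_{1,0}\ge c_{2,0}$, and let $C_i:=\{x\in\mathbb{K}_2^n:\ c_i^\top x\ge c_{i,0}\}$ for $i\in\{1,2\}$. Suppose that $C_1\not\subseteq C_2$, $C_2\not\subseteq C_1$, and $C_i\cap\operatorname{int}\mathbb{K}_2^n\ne\emptyset$ for $i\in\{1,2\}$. Let $\beta>0$ be such that $\beta c_{1,0}\ge c_{2,0}$ and $\beta c_1-c_2\notin\pm\mathbb{K}_2^n$, and set $$\mathcal{N}_1(\beta):=\|\beta\tilde c_1-\tilde c_2\|_2^2-(\beta c_{1,n}-c_{2,n})^2 .$$ Then the inequality $$2c_{2,0}-(\beta c_1+c_2)^\top x\ \le\ \sqrt{\big((\beta c_1-c_2)^\top x\big)^2+\mathcal{N}_1(\beta)\big(x_n^2-\|\tilde x\|_2^2\big)}\qquad(\ast)$$ is valid for $\overline{\mathrm{conv}}(C_1\cup C_2)$, i.e. every $x\in\overline{\mathrm{conv}}(C_1\cup C_2)$ satisfies $(\ast)$. Moreover, $(\ast)$ implies all valid linear inequalities $\mu^\top x\ge c_{2,0}$ for which there exist $\alpha_1,\alpha_2\in\operatorname{bd}\mathbb{K}_2^n$ with $\mu=\alpha_1+\beta c_1=\alpha_2+c_2$; that is, every $x\in\mathbb{K}_2^n$ satisfying $(\ast)$ satisfies $\mu^\top x\ge c_{2,0}$ for every such $\mu$.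
   Context: For $x\in\mathbb{R}^n$, $\tilde x:=(x_1;\dots;x_{n-1})\in\mathbb{R}^{n-1}$, and $c_{i,n}$ denotes the $n$-th entry of $c_i$, $\tilde c_i$ its first $n-1$ entries. The second-order cone is $\mathbb{K}_2^n:=\{x\in\mathbb{R}^n:\|\tilde x\|_2\le x_n\}$; it is self-dual. $\operatorname{int}$ and $\operatorname{bd}$ denote interior and boundary, and $\overline{\mathrm{conv}}$ denotes the closed convex hull. The notation $v\notin\pm\mathbb{K}$ means $v\notin\mathbb{K}$ and $v\notin-\mathbb{K}$. *)

(* Defs.v *)
From HB Require Import structures.
From mathcomp Require Import all_boot all_order all_algebra.
From mathcomp Require Import all_classical all_reals all_analysis.

Set Implicit Arguments.
Unset Strict Implicit.
Unset Printing Implicit Defensive.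

Import Order.TTheory GRing.Theory Num.Theory.
Import numFieldNormedType.Exports.

Local Open Scope classical_set_scope.
Local Open Scope ring_scope.

(* The ambient space R^n, n >= 1, is 'cV[R]_n.+1. Its canonical norm is the sup
   norm, so the Euclidean norm is defined separately; the two norms induce the
   same topology, hence [interior], [closure] and [closed] are the usual ones. *)

Definition dotv (R : realType) (n : nat) (u v : 'cV[R]_n) : R :=
  (u^T *m v) ord0 ord0.

Definition norm2 (R : realType) (n : nat) (u : 'cV[R]_n) : R :=
  Num.sqrt (\sum_(i < n) u i ord0 ^+ 2).

Definition vlast (R : realType) (n : nat) (x : 'cV[R]_n.+1) : R :=
  x ord_max ord0.

Definition vtilde (R : realType) (n : nat) (x : 'cV[R]_n.+1) : 'cV[R]_n :=
  row' ord_max x.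

Definition soc (R : realType) (n : nat) : set 'cV[R]_n.+1 :=
  [set x | norm2 (vtilde x) <= vlast x].
Arguments soc {R n}.

Definition boundary (T : topologicalType) (A : set T) : set T :=
  closure A `\` interior A.

Definition closed_convex_hull (R : realType) (n : nat) (A : set 'cV[R]_n.+1) :
    set 'cV[R]_n.+1 :=
  smallest [set B : set 'cV[R]_n.+1 | closed B /\ convex_set B] A.

Definition soc_halfspace (R : realType) (n : nat) (c : 'cV[R]_n.+1) (c0 : R) :
    set 'cV[R]_n.+1 :=
  [set x | soc x /\ c0 <= dotv c x].

Definition calN1 (R : realType) (n : nat) (c1 c2 : 'cV[R]_n.+1) (beta : R) : R :=
  norm2 (beta *: vtilde c1 - vtilde c2) ^+ 2
  - (beta * vlast c1 - vlast c2) ^+ 2.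

(* [Num.sqrt] is 0 on negative arguments, but for [x] in [soc] the radicand is
   nonnegative as soon as [beta *: c1 - c2] lies in neither [soc] nor [- soc],
   since then [calN1 c1 c2 beta > 0]. *)
Definition disj_ineq (R : realType) (n : nat) (c1 c2 : 'cV[R]_n.+1)
    (c20 beta : R) (x : 'cV[R]_n.+1) : Prop :=
  2 * c20 - dotv (beta *: c1 + c2) x <=
  Num.sqrt (dotv (beta *: c1 - c2) x ^+ 2
            + calN1 c1 c2 beta * (vlast x ^+ 2 - norm2 (vtilde x) ^+ 2)).

(* Main.v *)
Require Import Defs.
From HB Require Import structures.
From mathcomp Require Import all_boot all_order all_algebra.
From mathcomp Require Import all_classical all_reals all_analysis.
From mathcomp Require Import ring lra.

Set Implicit Arguments.
Unset Strict Implicit.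
Unset Printing Implicit Defensive.

Import Order.TTheory GRing.Theory Num.Theory.
Import numFieldNormedType.Exports.
Local Open Scope classical_set_scope.
Local Open Scope ring_scope.

(** Let d = beta c1 - c2 and write <u, v> for the Lorentz form
    u_n v_n - u~ . v~, so that the cone is the set of x with x_n >= 0 and
    <x, x> >= 0. That d lies in neither the cone nor its opposite means that
    N = - <d, d> is positive, and the radicand of the inequality is
    (d . x)^2 + N <x, x>.

    Let w be d with its first n-1 entries negated, so that <w, x> = d . x. The
    map x |-> N x + <w, x> w is N times the projection onto the Lorentz
    orthogonal of the spacelike vector w. It sends the cone into itself
    ([soc_orth_proj]), and the Lorentz square of the image of x is N times the
    radicand. The square root in the inequality is thus, up to the factor
    sqrt N, the Lorentz length of a linear image of x inside the cone. Both
    halves of the theorem follow from the reversed Cauchy-Schwarz inequality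
    on the cone, sqrt <u, u> sqrt <v, v> <= <u, v> ([lorentz_ge_lnorm]).

    Validity: Lorentz length is superadditive on the cone ([lnormD]), so the
    square root is concave there and the points of the cone satisfying the
    inequality form a closed convex set ([closed_convex_disj_ineq]). This set
    contains both pieces of the disjunction ([disj_ineq_of_halfspace]): the
    square root is at least |beta c1 . x - c2 . x|, and
    max (a, b) = (a + b + |a - b|) / 2, so the inequality holds as soon as
    one of beta c1 . x and c2 . x is at least c20.

    Strength: if alpha1 + beta c1 = alpha2 + c2 with alpha1 and alpha2 on the
    boundary of the cone, then d = alpha2 - alpha1 is a difference of null
    vectors. Hence s = alpha1 + alpha2 is Lorentz orthogonal to d and
    <s, s> = N, and reversed Cauchy-Schwarz applied to the image of x and to s
    with its first n-1 entries negated bounds the square root by s . x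
    ([sqrt_radicand_le]). The inequality then gives
    2 c20 <= (beta c1 + c2) . x + (alpha1 + alpha2) . x, which is twice mu . x
    ([linear_ineq_of_disj_ineq]). *)

(** * Euclidean inner product *)

Section EuclideanSpace.
Context {R : realType} {n : nat}.
Implicit Types (u v w : 'cV[R]_n) (a : R).

Lemma dotvE u v : dotv u v = \sum_i u i ord0 * v i ord0.
Proof. by rewrite /dotv mxE; apply: eq_bigr => i _; rewrite mxE. Qed.

Lemma dotvC u v : dotv u v = dotv v u.
Proof. by rewrite !dotvE; apply: eq_bigr => i _; rewrite mulrC. Qed.

Lemma dotvDl u v w : dotv (u + v) w = dotv u w + dotv v w.
Proof. by rewrite /dotv linearD mulmxDl mxE. Qed.

Lemma dotvZl a u w : dotv (a *: u) w = a * dotv u w.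
Proof. by rewrite /dotv linearZ -scalemxAl mxE. Qed.

Lemma dotvNl u w : dotv (- u) w = - dotv u w.
Proof. by rewrite -scaleN1r dotvZl mulN1r. Qed.

Lemma dotvDr u v w : dotv w (u + v) = dotv w u + dotv w v.
Proof. by rewrite !(dotvC w) dotvDl. Qed.

Lemma dotvZr a u w : dotv w (a *: u) = a * dotv w u.
Proof. by rewrite !(dotvC w) dotvZl. Qed.

Lemma dotvNr u w : dotv w (- u) = - dotv w u.
Proof. by rewrite !(dotvC w) dotvNl. Qed.

Lemma dotvv_ge0 u : 0 <= dotv u u.
Proof. by rewrite dotvE sumr_ge0 // => i _; rewrite -expr2 sqr_ge0. Qed.

Lemma dotvv_eq0 u : dotv u u = 0 -> u = 0.
Proof.
rewrite dotvE => /eqP; rewrite psumr_eq0 => [/allP u0|i _]; last first.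
  by rewrite -expr2 sqr_ge0.
apply/matrixP => i j; rewrite ord1 mxE; apply/eqP.
by have := u0 i (mem_index_enum i); rewrite mulf_eq0 orbb.
Qed.

Lemma norm2_ge0 u : 0 <= norm2 u.
Proof. exact: sqrtr_ge0. Qed.

Lemma sqr_norm2 u : norm2 u ^+ 2 = dotv u u.
Proof.
rewrite /norm2 sqr_sqrtr ?dotvE; first by apply: eq_bigr => i _; rewrite expr2.
by apply: sumr_ge0 => i _; rewrite sqr_ge0.
Qed.

Lemma norm2N u : norm2 (- u) = norm2 u.
Proof.
by apply: (@pexpIrn _ 2); rewrite ?nnegrE ?norm2_ge0// !sqr_norm2 dotvNl dotvNr opprK.
Qed.

(** Cauchy-Schwarz, from the nonnegativity of the square of
    [dotv v v *: u - dotv u v *: v]. *)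
Lemma ler_norm_dotv u v : `|dotv u v| <= norm2 u * norm2 v.
Proof.
rewrite -(@ler_pXn2r _ 2) ?nnegrE ?mulr_ge0 ?norm2_ge0//.
rewrite real_normK ?num_real// exprMn !sqr_norm2.
have [/dotvv_eq0 ->|v0] := eqVneq (dotv v v) 0.
  by rewrite -(scale0r 0) !dotvZr !mul0r mulr0 expr0n.
have vv : 0 < dotv v v by rewrite lt_def v0 dotvv_ge0.
have := dotvv_ge0 (dotv v v *: u - dotv u v *: v).
rewrite !(dotvDl, dotvDr, dotvNl, dotvNr, dotvZl, dotvZr) (dotvC v u).
set a := dotv u u; set b := dotv u v; set c := dotv v v in vv *.
rewrite [X in 0 <= X](_ : _ = c * (a * c - b ^+ 2)); last by ring.
by rewrite pmulr_rge0// subr_ge0.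
Qed.

Lemma dotv_continuous u : continuous (dotv u).
Proof.
rewrite (_ : dotv u = fun v => \sum_i u i ord0 * v i ord0); last first.
  by apply/funext => v; rewrite dotvE.
apply: continuous_big => [|i _ v]; first exact: add_continuous.
apply: continuousM; first exact: cst_continuous.
exact: coord_continuous.
Qed.

End EuclideanSpace.

(** * Lorentz form and its reversed inequalities on the cone *)

Section LorentzForm.
Context {R : realType} {n : nat}.
Implicit Types (u v w x y : 'cV[R]_n.+1) (a : R).

Lemma vtildeD u v : vtilde (u + v) = vtilde u + vtilde v.
Proof. by apply/matrixP => i j; rewrite !mxE. Qed.

Lemma vtildeZ a u : vtilde (a *: u) = a *: vtilde u.
Proof. by apply/matrixP => i j; rewrite !mxE. Qed.

Lemma vtildeN u : vtilde (- u) = - vtilde u.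
Proof. by apply/matrixP => i j; rewrite !mxE. Qed.

Lemma vlastD u v : vlast (u + v) = vlast u + vlast v.
Proof. by rewrite /vlast mxE. Qed.

Lemma vlastZ a u : vlast (a *: u) = a * vlast u.
Proof. by rewrite /vlast mxE. Qed.

Lemma vlastN u : vlast (- u) = - vlast u.
Proof. by rewrite /vlast mxE. Qed.

Lemma dotv_split u v :
  dotv u v = dotv (vtilde u) (vtilde v) + vlast u * vlast v.
Proof.
rewrite !dotvE (bigD1_ord ord_max)//= addrC; congr (_ + _).
by apply: eq_bigr => i _; rewrite !mxE.
Qed.

Definition lorentz u v := vlast u * vlast v - dotv (vtilde u) (vtilde v).

Lemma lorentzC u v : lorentz u v = lorentz v u.
Proof. by rewrite /lorentz mulrC dotvC. Qed.

Lemma lorentzDl u v w : lorentz (u + v) w = lorentz u w + lorentz v w.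
Proof. by rewrite /lorentz vlastD vtildeD dotvDl; ring. Qed.

Lemma lorentzZl a u w : lorentz (a *: u) w = a * lorentz u w.
Proof. by rewrite /lorentz vlastZ vtildeZ dotvZl; ring. Qed.

Lemma lorentzDr u v w : lorentz w (u + v) = lorentz w u + lorentz w v.
Proof. by rewrite !(lorentzC w) lorentzDl. Qed.

Lemma lorentzZr a u w : lorentz w (a *: u) = a * lorentz w u.
Proof. by rewrite !(lorentzC w) lorentzZl. Qed.

Lemma lorentzvv u : lorentz u u = vlast u ^+ 2 - norm2 (vtilde u) ^+ 2.
Proof. by rewrite sqr_norm2 expr2. Qed.

(** Squaring turns the norm inequality that defines the cone into a quadratic
    one, to which bilinear algebra applies. *)
Lemma socP u : soc u <-> 0 <= vlast u /\ 0 <= lorentz u u.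
Proof.
rewrite lorentzvv subr_ge0; split => [su|[u0]].
  have u0 : 0 <= vlast u by apply: le_trans _ su; exact: norm2_ge0.
  by rewrite ler_pXn2r ?nnegrE ?norm2_ge0.
by rewrite ler_pXn2r ?nnegrE ?norm2_ge0.
Qed.

Definition lnorm u := Num.sqrt (lorentz u u).

(** Reversed Cauchy-Schwarz. By ordinary Cauchy-Schwarz on the first n-1
    entries, [lorentz u v] is at least a b - s t, where a, b are the last
    entries and s, t the norms of the others; and (a b - s t)^2 exceeds
    (a^2 - s^2) (b^2 - t^2) by the square (a t - b s)^2. *)
Lemma lorentz_ge_lnorm u v : soc u -> soc v -> lnorm u * lnorm v <= lorentz u v.
Proof.
move=> su sv; have [u0 uu] := (socP u).1 su; have [v0 vv] := (socP v).1 sv.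
have su' := norm2_ge0 (vtilde u); have sv' := norm2_ge0 (vtilde v).
have cs : norm2 (vtilde u) * norm2 (vtilde v) <= vlast u * vlast v.
  exact: ler_pM.
apply: (@le_trans _ _ (vlast u * vlast v - norm2 (vtilde u) * norm2 (vtilde v))).
  rewrite -(@ler_pXn2r _ 2) ?nnegrE ?subr_ge0 ?mulr_ge0 ?sqrtr_ge0//.
  rewrite exprMn !sqr_sqrtr// !lorentzvv.
  rewrite -subr_ge0.
  set a := vlast u; set b := vlast v; set s := norm2 _; set t := norm2 _.
  have -> : (a * b - s * t) ^+ 2 - (a ^+ 2 - s ^+ 2) * (b ^+ 2 - t ^+ 2)
    = (a * t - b * s) ^+ 2 by ring.
  exact: sqr_ge0.
rewrite /lorentz lerD2l lerN2.
by apply: le_trans (ler_norm _) (ler_norm_dotv _ _).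
Qed.

Lemma lorentz_ge0 u v : soc u -> soc v -> 0 <= lorentz u v.
Proof.
move=> su sv; apply: le_trans _ (lorentz_ge_lnorm su sv).
by rewrite mulr_ge0 ?sqrtr_ge0.
Qed.

Lemma socD u v : soc u -> soc v -> soc (u + v).
Proof.
move=> su sv; apply/socP; have [u0 uu] := (socP u).1 su.
have [v0 vv] := (socP v).1 sv; have uv := lorentz_ge0 su sv.
rewrite vlastD addr_ge0// lorentzDl !lorentzDr (lorentzC v u).
by split=> //; apply: addr_ge0; apply: addr_ge0.
Qed.

Lemma socZ a u : 0 <= a -> soc u -> soc (a *: u).
Proof.
move=> a0 /socP[u0 uu]; apply/socP.
by rewrite vlastZ lorentzZl lorentzZr !mulr_ge0.
Qed.

(** Reversed triangle inequality: this is the source of the concavity of the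
    right-hand side of the disjunctive inequality. *)
Lemma lnormD u v : soc u -> soc v -> lnorm u + lnorm v <= lnorm (u + v).
Proof.
move=> su sv; have [_ uu] := (socP u).1 su; have [_ vv] := (socP v).1 sv.
have [_ uv] := (socP _).1 (socD su sv).
rewrite -(@ler_pXn2r _ 2) ?nnegrE ?addr_ge0 ?sqrtr_ge0// sqrrD !sqr_sqrtr//.
rewrite lorentzDl !lorentzDr (lorentzC v u).
by have := lorentz_ge_lnorm su sv; rewrite /lnorm; lra.
Qed.

(** The projection onto the Lorentz orthogonal of [w], multiplied by
    [- lorentz w w] so that no division is needed. *)
Definition orth_proj w x := - lorentz w w *: x + lorentz w x *: w.

Lemma orth_projD w x y :
  orth_proj w (x + y) = orth_proj w x + orth_proj w y.
Proof. by rewrite /orth_proj lorentzDr scalerDr scalerDl addrACA. Qed.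

Lemma lorentz_orth_proj w x : lorentz (orth_proj w x) (orth_proj w x) =
  - lorentz w w * (lorentz w x ^+ 2 - lorentz w w * lorentz x x).
Proof.
rewrite /orth_proj !(lorentzDl, lorentzDr, lorentzZl, lorentzZr) (lorentzC x w).
ring.
Qed.

(** For spacelike [w], that is [lorentz w w < 0], the orthogonal of [w] meets
    the inside of the cone, and removing the component along [w] only increases
    the Lorentz square. The last entry of the image is
    |w~|^2 x_n - w_n (w~ . x~), nonnegative because |w_n| <= |w~| and
    |w~ . x~| <= |w~| x_n. *)
Lemma soc_orth_proj w x : lorentz w w < 0 -> soc x -> soc (orth_proj w x).
Proof.
move=> ww sx; have [x0 xx] := (socP x).1 sx; apply/socP; split; last first.
  rewrite lorentz_orth_proj mulr_ge0//; first by rewrite oppr_ge0 ltW.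
  by rewrite -mulNr addr_ge0 ?sqr_ge0// mulr_ge0// oppr_ge0 ltW.
have ->: vlast (orth_proj w x) = norm2 (vtilde w) ^+ 2 * vlast x
    - vlast w * dotv (vtilde w) (vtilde x).
  rewrite vlastD !vlastZ lorentzvv /lorentz; ring.
have hw : `|vlast w| <= norm2 (vtilde w).
  rewrite -(@ler_pXn2r _ 2) ?nnegrE ?norm2_ge0// real_normK ?num_real//.
  by rewrite -subr_le0 -lorentzvv ltW.
rewrite subr_ge0; apply: le_trans (ler_norm _) _.
rewrite normrM expr2 -mulrA ler_pM//; apply: le_trans (ler_norm_dotv _ _) _.
by rewrite ler_wpM2l ?norm2_ge0.
Qed.

(** Negates all entries but the last. It is an isometry of the Lorentz form
    which converts that form into the Euclidean product and back. *)
Definition time_reflect x : 'cV[R]_n.+1 := (2 * vlast x) *: delta_mx ord_max ord0 - x.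

Lemma vlast_time_reflect x : vlast (time_reflect x) = vlast x.
Proof. by rewrite /vlast !mxE !eqxx /= mulr1 mulr2n mulrDl mul1r addrK. Qed.

Lemma vtilde_time_reflect x : vtilde (time_reflect x) = - vtilde x.
Proof.
apply/matrixP => i j.
by rewrite !mxE eq_sym (negPf (neq_lift _ _)) mulr0 add0r.
Qed.

Lemma lorentz_time_reflect x y : lorentz (time_reflect x) y = dotv x y.
Proof.
rewrite /lorentz vlast_time_reflect vtilde_time_reflect dotvNl opprK addrC.
by rewrite dotv_split.
Qed.

Lemma lorentz_time_reflect2 x y :
  lorentz (time_reflect x) (time_reflect y) = lorentz x y.
Proof.
by rewrite /lorentz !vlast_time_reflect !vtilde_time_reflect dotvNl dotvNr opprK.
Qed.

Lemma lnorm_time_reflect x : lnorm (time_reflect x) = lnorm x.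
Proof. by rewrite /lnorm lorentz_time_reflect2. Qed.

Lemma soc_time_reflect x : soc x -> soc (time_reflect x).
Proof. by rewrite /soc/= vtilde_time_reflect vlast_time_reflect norm2N. Qed.

(** The radicand of the disjunctive inequality, with [d = beta *: c1 - c2]
    ([disj_ineqE]). *)
Definition radicand d x := dotv d x ^+ 2 - lorentz d d * lorentz x x.

Lemma lnorm_orth_proj d x : lorentz d d < 0 ->
  lnorm (orth_proj (time_reflect d) x)
  = Num.sqrt (- lorentz d d) * Num.sqrt (radicand d x).
Proof.
move=> dd; rewrite /lnorm lorentz_orth_proj.
by rewrite lorentz_time_reflect2 lorentz_time_reflect sqrtrM // oppr_ge0 ltW.
Qed.

Lemma sqrt_radicandZ d a x : 0 <= a ->
  Num.sqrt (radicand d (a *: x)) = a * Num.sqrt (radicand d x).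
Proof.
move=> a0; have -> : radicand d (a *: x) = a ^+ 2 * radicand d x.
  by rewrite /radicand dotvZr lorentzZl lorentzZr; ring.
by rewrite sqrtrM ?sqr_ge0// sqrtr_sqr ger0_norm.
Qed.

Lemma sqrt_radicandD d x y : lorentz d d < 0 -> soc x -> soc y ->
  Num.sqrt (radicand d x) + Num.sqrt (radicand d y)
  <= Num.sqrt (radicand d (x + y)).
Proof.
move=> dd sx sy.
have sd : 0 < Num.sqrt (- lorentz d d) by rewrite sqrtr_gt0 oppr_gt0.
rewrite -(ler_pM2l sd) mulrDr -!lnorm_orth_proj// orth_projD.
by apply: lnormD; apply: soc_orth_proj => //; rewrite lorentz_time_reflect2.
Qed.

(** Reversed Cauchy-Schwarz between the projection of [x] along
    [time_reflect d] and [time_reflect s]: since the latter is orthogonal to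
    [time_reflect d], the projection can be dropped from their product, which
    is then a multiple of [dotv s x]. *)
Lemma sqrt_radicand_le d s x : lorentz d d < 0 -> lorentz d s = 0 ->
  soc s -> soc x ->
  lnorm s * Num.sqrt (radicand d x) <= Num.sqrt (- lorentz d d) * dotv s x.
Proof.
move=> dd ds ss sx.
have sd : 0 < Num.sqrt (- lorentz d d) by rewrite sqrtr_gt0 oppr_gt0.
have sw : soc (orth_proj (time_reflect d) x).
  by apply: soc_orth_proj => //; rewrite lorentz_time_reflect2.
have := lorentz_ge_lnorm sw (soc_time_reflect ss).
rewrite lnorm_orth_proj// lnorm_time_reflect.
rewrite lorentzDl !lorentzZl !lorentz_time_reflect2 ds mulr0 addr0.
rewrite (lorentzC x) lorentz_time_reflect -mulrA (mulrC _ (lnorm s)).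
have nd : 0 <= - lorentz d d by rewrite oppr_ge0 ltW.
by rewrite -{2}(sqr_sqrtr nd) expr2 -mulrA ler_pM2l.
Qed.

(** * Continuity and topology of the cone *)

Lemma continuous_sqr (T : topologicalType) (f : T -> R) :
  continuous f -> continuous (fun t => f t ^+ 2).
Proof.
by move=> cf t; apply: (@continuous_comp _ _ _ f (fun r : R => r ^+ 2));
  [exact: cf|exact: exprn_continuous].
Qed.

Lemma vlast_continuous : continuous (@vlast R n).
Proof. exact: coord_continuous. Qed.

Lemma norm2_vtilde_continuous : continuous (fun x => norm2 (vtilde x)).
Proof.
move=> x; apply: (@continuous_comp _ _ _
  (fun x => \sum_i (vtilde x) i ord0 ^+ 2) (@Num.sqrt R)); last first.
  exact: sqrt_continuous.
apply: continuous_big => [|i _ v]; first exact: add_continuous.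
apply: continuous_sqr => {v} v.
rewrite (_ : (fun v => vtilde v i ord0) = fun v => v (lift ord_max i) ord0).
  exact: coord_continuous.
by apply/funext => u; rewrite mxE.
Qed.

Let gap x := vlast x - norm2 (vtilde x).

Let gap_continuous : continuous gap.
Proof.
by move=> x; apply: continuousB; [exact: vlast_continuous|exact: norm2_vtilde_continuous].
Qed.

Lemma closed_soc : closed (@soc R n).
Proof.
rewrite (_ : soc = gap @^-1` [set t | 0 <= t]).
  by apply: preimage_closed; [move=> x _; exact: gap_continuous|exact: closed_ge].
by apply/seteqP; split => x /=; rewrite /gap subr_ge0.
Qed.

(** A point of the cone where the defining inequality is strict is interior. *)
Lemma boundary_soc x : boundary soc x -> soc x /\ lorentz x x = 0.
Proof.
case=> cx ix; have sx : soc x by exact: closed_soc.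
split=> //; rewrite lorentzvv; apply/eqP; rewrite subr_eq0; apply/eqP.
congr (_ ^+ 2); apply/eqP; rewrite eq_le [X in _ && X]sx andbT leNgt.
apply/negP => lt_x; apply: ix.
have op : open (gap @^-1` [set t | 0 < t]).
  by apply: open_comp; [move=> y _; exact: gap_continuous|exact: open_gt].
suff: gap @^-1` [set t | 0 < t] `<=` interior soc by
  apply; rewrite /= /gap subr_gt0.
by rewrite -open_subsetE// => y /=; rewrite /gap subr_gt0 => /ltW.
Qed.

Lemma radicand_continuous d : continuous (radicand d).
Proof.
pose q x := vlast x ^+ 2 - norm2 (vtilde x) ^+ 2.
have q_cont : continuous q.
  move=> x; apply: (@continuousB _ R^o _ (fun x => vlast x ^+ 2)
    (fun x => norm2 (vtilde x) ^+ 2)).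
    exact/continuous_sqr/vlast_continuous.
  exact/continuous_sqr/norm2_vtilde_continuous.
rewrite (_ : radicand d = fun x => dotv d x ^+ 2 - lorentz d d * q x); last first.
  by apply/funext => x; rewrite /q -lorentzvv.
move=> x; apply: (@continuousB _ R^o _ (fun x => dotv d x ^+ 2)
  (fun x => lorentz d d * q x)).
  exact/continuous_sqr/dotv_continuous.
by apply: continuousM; [exact: cst_continuous|exact: q_cont].
Qed.

End LorentzForm.

(** * The disjunctive inequality *)

Section DisjunctiveCut.
Context {R : realType} {n : nat}.
Implicit Types x d : 'cV[R]_n.+1.

Lemma disj_ineqE (c1 c2 : 'cV[R]_n.+1) c20 beta x : disj_ineq c1 c2 c20 beta x =
  (2 * c20 - dotv (beta *: c1 + c2) x
    <= Num.sqrt (radicand (beta *: c1 - c2) x)).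
Proof.
rewrite /disj_ineq /radicand /calN1.
congr (_ <= Num.sqrt (_ + _)); rewrite -lorentzvv -[RHS]mulNr.
congr (_ * _); rewrite lorentzvv [RHS]opprB.
by rewrite vtildeD vtildeN vtildeZ vlastD vlastN vlastZ.
Qed.

(** Avoiding both cones means |d~| > d_n and |d~| > - d_n; the Lorentz square of
    [d] is minus the product of the two positive gaps. *)
Lemma spacelike_of_notin_soc d : ~ soc d -> ~ (-%R @` soc) d ->
  lorentz d d < 0 :> R.
Proof.
move=> /negP; rewrite -ltNge => hp hn.
have {}hn : - vlast d < norm2 (vtilde d).
  rewrite ltNge; apply/negP => hd; apply: hn; exists (- d); last by rewrite opprK.
  by rewrite /soc/= vtildeN norm2N vlastN.
have -> : lorentz d d = - ((norm2 (vtilde d) - vlast d) * (norm2 (vtilde d) + vlast d)).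
  by rewrite lorentzvv; ring.
by rewrite oppr_lt0 mulr_gt0// ?subr_gt0// -ltrBlDr sub0r.
Qed.

(** The points where a concave function is at least an affine one form a convex
    set. *)
Lemma closed_convex_disj_ineq (c1 c2 : 'cV[R]_n.+1) c20 beta :
  lorentz (beta *: c1 - c2) (beta *: c1 - c2) < 0 ->
  closed (soc `&` disj_ineq c1 c2 c20 beta) /\
  convex_set (soc `&` disj_ineq c1 c2 c20 beta).
Proof.
move=> dd; split.
  apply: closedI; first exact: closed_soc.
  pose f x := Num.sqrt (radicand (beta *: c1 - c2) x) + dotv (beta *: c1 + c2) x.
  rewrite (_ : disj_ineq _ _ _ _ = f @^-1` [set t | 2 * c20 <= t]).
    apply: preimage_closed; last exact: closed_ge.
    move=> x _; apply: (@continuousD _ R^o _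
      (fun x => Num.sqrt (radicand (beta *: c1 - c2) x))
      (dotv (beta *: c1 + c2))); last exact: dotv_continuous.
    apply: (@continuous_comp _ _ _ (radicand _) (@Num.sqrt R)).
      exact: radicand_continuous.
    exact: sqrt_continuous.
  by apply/seteqP; split => x; rewrite disj_ineqE/= lerBlDr.
move=> x y t; rewrite !in_setE => -[sx]; rewrite disj_ineqE => dx [sy].
rewrite disj_ineqE => dy.
(* [conv t x y] puts the weight t on its first argument. *)
change ((soc `&` disj_ineq c1 c2 c20 beta) (t%:num *: x + (1 - t%:num) *: y)).
have t0 : 0 <= t%:num by [].
have t1 : 0 <= 1 - t%:num by rewrite subr_ge0.
have sx' := socZ t0 sx; have sy' := socZ t1 sy.
split; first exact: socD.
rewrite disj_ineqE; apply: le_trans _ (sqrt_radicandD dd sx' sy').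
rewrite !sqrt_radicandZ// (dotvDr (_ *: x)) (dotvZr _ x) (dotvZr _ y).
have := ler_wpM2l t0 dx; have := ler_wpM2l t1 dy; lra.
Qed.

(** With a = beta c1 . x and b = c2 . x, the radicand is at least (a - b)^2 and
    the inequality follows from 2 c20 - (a + b) <= |a - b|, that is,
    c20 <= max (a, b). *)
Lemma disj_ineq_of_halfspace (c1 c2 : 'cV[R]_n.+1) c20 beta x :
  lorentz (beta *: c1 - c2) (beta *: c1 - c2) < 0 -> soc x ->
  c20 <= beta * dotv c1 x \/ c20 <= dotv c2 x -> disj_ineq c1 c2 c20 beta x.
Proof.
move=> dd sx h; rewrite disj_ineqE; have [_ xx] := (socP x).1 sx.
apply: (@le_trans _ _ `|dotv (beta *: c1 - c2) x|); last first.
  by rewrite -sqrtr_sqr ler_wsqrtr// /radicand -mulNr lerDl mulr_ge0// oppr_ge0 ltW.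
rewrite !dotvDl dotvNl dotvZl.
set a := beta * _ in h *; set b := dotv c2 x in h *.
case: h => h.
  by apply: (@le_trans _ _ (a - b)); [lra|exact: ler_norm].
by rewrite distrC; apply: (@le_trans _ _ (b - a)); [lra|exact: ler_norm].
Qed.

(** The vector alpha1 + alpha2 is the one for which [sqrt_radicand_le] is sharp
    enough: as [beta *: c1 - c2 = alpha2 - alpha1] and the alphas are null, it
    is orthogonal to this difference and has the opposite Lorentz square. *)
Lemma linear_ineq_of_disj_ineq (c1 c2 : 'cV[R]_n.+1) c20 beta alpha1 alpha2 x :
  lorentz (beta *: c1 - c2) (beta *: c1 - c2) < 0 ->
  boundary soc alpha1 -> boundary soc alpha2 ->
  alpha1 + beta *: c1 = alpha2 + c2 ->
  soc x -> disj_ineq c1 c2 c20 beta x -> c20 <= dotv (alpha2 + c2) x.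
Proof.
move=> dd /boundary_soc[s1 n1] /boundary_soc[s2 n2] e sx; rewrite disj_ineqE.
have de : beta *: c1 - c2 = alpha2 - alpha1.
  by apply/eqP; rewrite subr_eq addrAC -e addrAC subrr add0r.
have dE : lorentz (alpha2 - alpha1) (alpha2 - alpha1) = - 2 * lorentz alpha1 alpha2.
  rewrite -scaleN1r !(lorentzDl, lorentzDr, lorentzZl, lorentzZr) n1 n2.
  by rewrite (lorentzC alpha2); ring.
have sE : lorentz (alpha1 + alpha2) (alpha1 + alpha2) = 2 * lorentz alpha1 alpha2.
  by rewrite !(lorentzDl, lorentzDr) n1 n2 (lorentzC alpha2); ring.
have ort : lorentz (alpha2 - alpha1) (alpha1 + alpha2) = 0.
  rewrite -scaleN1r !(lorentzDl, lorentzDr, lorentzZl, lorentzZr) n1 n2.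
  by rewrite (lorentzC alpha2); ring.
rewrite {}de in dd * => le_x.
have := sqrt_radicand_le dd ort (socD s1 s2) sx.
have -> : lnorm (alpha1 + alpha2) = Num.sqrt (- lorentz (alpha2 - alpha1) (alpha2 - alpha1)).
  by rewrite /lnorm dE sE; congr Num.sqrt; ring.
rewrite ler_pM2l ?sqrtr_gt0 ?oppr_gt0// => /(le_trans le_x).
have : dotv (alpha1 + beta *: c1) x = dotv (alpha2 + c2) x by rewrite e.
rewrite !dotvDl; lra.
Qed.

End DisjunctiveCut.

Unset Implicit Arguments.

Theorem theorem1 (R : realType) (n : nat) (c1 c2 : 'cV[R]_n.+1) (c10 c20 : R)
  (hc10 : c10 \in [:: 0; 1; -1]) (hc20 : c20 \in [:: 0; 1; -1])
  (hc : c20 <= c10)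
  (hC12 : ~ (soc_halfspace c1 c10 `<=` soc_halfspace c2 c20))
  (hC21 : ~ (soc_halfspace c2 c20 `<=` soc_halfspace c1 c10))
  (hint1 : soc_halfspace c1 c10 `&` interior soc !=set0)
  (hint2 : soc_halfspace c2 c20 `&` interior soc !=set0)
  (beta : R) (hbeta : 0 < beta) (hbetac : c20 <= beta * c10)
  (hpos : ~ soc (beta *: c1 - c2))
  (hneg : ~ (-%R @` soc) (beta *: c1 - c2)) :
  (forall x : 'cV[R]_n.+1,
     closed_convex_hull (soc_halfspace c1 c10 `|` soc_halfspace c2 c20) x ->
     disj_ineq c1 c2 c20 beta x) /\
  (forall mu : 'cV[R]_n.+1,
     (exists alpha1 alpha2 : 'cV[R]_n.+1,
        [/\ boundary soc alpha1, boundary soc alpha2,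
            mu = alpha1 + beta *: c1 & mu = alpha2 + c2]) ->
     forall x : 'cV[R]_n.+1,
       soc x -> disj_ineq c1 c2 c20 beta x -> c20 <= dotv mu x).
Proof.
have dd := spacelike_of_notin_soc hpos hneg; split.
  have cut := closed_convex_disj_ineq c20 dd.
  move=> x hx; apply: (smallest_sub cut _ hx).2 => y [] [sy hy]; split => //.
    apply: disj_ineq_of_halfspace => //; left; apply: le_trans hbetac _.
    by rewrite ler_pM2l.
  by apply: disj_ineq_of_halfspace => //; right.
move=> mu [alpha1 [alpha2 [b1 b2 -> e]]] x sx hx; rewrite e.
exact: (linear_ineq_of_disj_ineq dd b1 b2 e sx hx).
Qed.
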